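(* Let $n$ be an even integer with $n\le 20$. Then every matrix lying on any ray or any counter-ray of the Birkhoff polytope $\mathcal{B}_n$ is (a) orthostochastic, if $n\in\{2,4,8,12,16,20\}$; (b) unistochastic, if $n\in\{6,10,14,18\}$.
   Context: $\mathcal{B}_n$ denotes the set of $n\times n$ bistochastic matrices (real matrices with nonnegative entries whose rows and columns each sum to $1$). A bistochastic $B$ is unistochastic if there is a unitary $U$ with $B_{ij}=|U_{ij}|^2$ for all $i,j$, and orthostochastic if such a $U$ can be chosen real orthogonal. $W_n$ is the flat matrix with all entries $1/n$. For a permutation matrix $P$ of order $n$, the ray determined by $P$ is $\{\alpha P+(1-\alpha)W_n:\alpha\in[0,1]\}$ and the counter-ray determined by $P$ is $\{\alpha P+(1-\alpha)W_n:\alpha\in[-\tfrac{1}{n-1},0)\}$. *)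

(* Defs.v *)
From HB Require Import structures.
From mathcomp Require Import all_boot all_order all_algebra.
From mathcomp Require Import spectral complex.
From mathcomp Require Import classical_sets reals.

Set Implicit Arguments.
Unset Strict Implicit.
Unset Printing Implicit Defensive.

Import Order.TTheory GRing.Theory Num.Theory.

Local Open Scope ring_scope.
Local Open Scope complex_scope.
Local Open Scope classical_set_scope.

(* Complex numbers are R[i] for a real type R; on R[i], `|z| is the modulus,
   itself an element of R[i], whence the injections x%:C below. *)

Definition bistochastic (R : realType) (n : nat) : set 'M[R]_n :=
  [set B | [/\ forall i j, 0 <= B i j,
               forall i, \sum_j B i j = 1
             & forall j, \sum_i B i j = 1]].

Definition unistochastic (R : realType) (n : nat) : set 'M[R]_n :=
  [set B | bistochastic B /\
     exists2 U : 'M[R[i]]_n, U \is unitarymx &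
       forall i j, (B i j)%:C = `|U i j| ^+ 2].

Definition orthogonal_mx (R : realType) (n : nat) (O : 'M[R]_n) : Prop :=
  O *m O^T = 1%:M.

Definition orthostochastic (R : realType) (n : nat) : set 'M[R]_n :=
  [set B | bistochastic B /\
     exists2 O : 'M[R]_n, orthogonal_mx O &
       forall i j, B i j = `|O i j| ^+ 2].

Definition flat_mx (R : realType) (n : nat) : 'M[R]_n := const_mx n%:R^-1.

Definition ray (R : realType) (n : nat) (P : 'M[R]_n) : set 'M[R]_n :=
  [set alpha *: P + (1 - alpha) *: flat_mx R n |
     alpha in [set a : R | 0 <= a <= 1]].

Definition counter_ray (R : realType) (n : nat) (P : 'M[R]_n) : set 'M[R]_n :=
  [set alpha *: P + (1 - alpha) *: flat_mx R n |
     alpha in [set a : R | - (n%:R - 1)^-1 <= a < 0]].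

(* Main.v *)
(** If [C] is a conference matrix of order [n] with [C^T = -C], then
    [x + y C] is orthogonal as soon as [x^2 + (n - 1) y^2 = 1]; if [C^T = C],
    then [x + i y C] is unitary.  Since [C] vanishes on the diagonal and has
    entries [1] or [-1] elsewhere, the squared moduli of the entries are [x^2]
    on the diagonal and [y^2] off it, and a permutation of the rows gives every
    point of the ray or counter-ray of [P].  It remains to exhibit skew
    conference matrices of orders 2, 4, 8, 12, 16, 20 and symmetric ones of
    orders 6, 10, 14, 18; all of them can be assembled from two negacyclic
    blocks. *)
Require Import Defs.
From mathcomp Require Import all_boot all_order all_algebra.
From mathcomp Require Import fingroup perm spectral complex ring.
From mathcomp Require Import classical_sets reals.

Import Order.TTheory GRing.Theory Num.Theory.

Local Open Scope ring_scope.
Local Open Scope classical_set_scope.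

(* [e = 1] for symmetric and [e = -1] for skew-symmetric matrices. *)
Definition conference (n : nat) (e : int) (C : 'M[int]_n) : Prop :=
  [/\ C^T = e *: C, forall i j, C i j ^+ 2 = (i != j)%:R
    & C *m C^T = (n%:R - 1)%:M].

Definition negacyclic (a : seq int) (i j : nat) : int :=
  if (i <= j)%N then a`_(j - i) else - a`_(size a + j - i).

(* The entries of [[A, B], [e B^T, -A]], where [A] and [B] are the negacyclic
   matrices with first rows [a] and [b]. *)
Definition two_negacyclic (e : int) (a b : seq int) (i j : nat) : int :=
  let m := size a in
  if (i < m)%N then
    if (j < m)%N then negacyclic a i j else negacyclic b i (j - m)
  else
    if (j < m)%N then e * negacyclic b j (i - m)
    else - negacyclic a (i - m) (j - m).

(** Indices are plain [nat] and sums are folds over [iota], so that [vm_compute] can evaluate the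
    test; [\matrix] and [\sum] terms are locked. *)
Definition conferenceb (n : nat) (e : int) (f : nat -> nat -> int) : bool :=
  all (fun i => all (fun j =>
    [&& f j i == e * f i j, f i j ^+ 2 == (i != j)%:R
      & foldr +%R 0 [seq f i k * f j k | k <- iota 0 n]
          == (n%:R - 1) *+ (i == j)])
    (iota 0 n)) (iota 0 n).

Lemma conferencebP (n : nat) (e : int) (f : nat -> nat -> int) :
  conferenceb n e f -> conference n e (\matrix_(i, j) f i j).
Proof.
move=> /allP f_conf.
have {}f_conf (i j : 'I_n) : [/\ f j i = e * f i j, f i j ^+ 2 = (i != j)%:R
    & \sum_(k < n) f i k * f j k = (n%:R - 1) *+ (i == j)].
  have in_iota (k : 'I_n) : (k : nat) \in iota 0 n by rewrite mem_iota /=.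
  have /allP/(_ j (in_iota j))/and3P[/eqP f_tr /eqP f_sq /eqP f_gram] :=
    f_conf i (in_iota i).
  split=> //; rewrite -[RHS]f_gram foldrE big_map -[X in iota 0 X]subn0.
  by rewrite -/(index_iota 0 n) big_mkord.
split=> [|i j|].
- by apply/matrixP=> i j; rewrite !mxE; have [] := f_conf i j.
- by rewrite mxE; have [] := f_conf i j.
- apply/matrixP=> i j; have [_ _ gram] := f_conf i j.
  by rewrite !mxE -gram; apply: eq_bigr => k _; rewrite !mxE.
Qed.

(** Negacyclic matrices commute, so when [A^T = e A] the off-diagonal blocks of the Gram matrix
    vanish and the diagonal ones only require [A A^T + B B^T = (n - 1) I]. Skewness of [A] means
    that [a] is palindromic after its leading [0]. *)
Lemma skew_conference_exists (n : nat) :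
  n \in [:: 2; 4; 8; 12; 16; 20]%N -> exists C, conference n (-1) C.
Proof.
have exC m a b (C_conf : conferenceb m (-1) (two_negacyclic (-1) a b)) :
    exists C, conference m (-1) C.
  by exists (\matrix_(i, j) two_negacyclic (-1) a b i j); apply: conferencebP.
rewrite !inE => /or4P[/eqP->|/eqP->|/eqP->|/or3P[]/eqP->].
- by apply: (exC _ [:: 0] [:: 1]); vm_compute.
- by apply: (exC _ [:: 0; 1] [:: 1; 1]); vm_compute.
- by apply: (exC _ [:: 0; 1; 1; 1] [:: 1; 1; -1; 1]); vm_compute.
- by apply: (exC _ [:: 0; 1; 1; -1; 1; 1] [:: 1; 1; 1; 1; -1; 1]); vm_compute.
- by apply: (exC _ [:: 0; 1; 1; 1; -1; 1; 1; 1]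
    [:: 1; 1; 1; -1; 1; 1; -1; 1]); vm_compute.
- by apply: (exC _ [:: 0; 1; 1; 1; 1; -1; 1; 1; 1; 1]
    [:: 1; 1; -1; 1; -1; 1; -1; -1; 1; 1]); vm_compute.
Qed.

(** Symmetry of [A] means [a_k = - a_(m - k)] for [0 < k < m]. Since only [a_0] is zero, the block
    size [m] must be odd, whence orders congruent to 2 modulo 4. *)
Lemma symmetric_conference_exists (n : nat) :
  n \in [:: 6; 10; 14; 18]%N -> exists C, conference n 1 C.
Proof.
have exC m a b (C_conf : conferenceb m 1 (two_negacyclic 1 a b)) :
    exists C, conference m 1 C.
  by exists (\matrix_(i, j) two_negacyclic 1 a b i j); apply: conferencebP.
rewrite !inE => /or4P[]/eqP->.
- by apply: (exC _ [:: 0; 1; -1] [:: 1; 1; 1]); vm_compute.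
- by apply: (exC _ [:: 0; 1; 1; -1; -1] [:: 1; 1; 1; -1; 1]); vm_compute.
- by apply: (exC _ [:: 0; 1; 1; 1; -1; -1; -1]
    [:: 1; 1; -1; 1; -1; 1; 1]); vm_compute.
- by apply: (exC _ [:: 0; 1; 1; 1; -1; 1; -1; -1; -1]
    [:: 1; 1; 1; -1; -1; 1; -1; 1; 1]); vm_compute.
Qed.

Lemma conference_diag (n : nat) (e : int) (C : 'M[int]_n) (i : 'I_n) :
  conference n e C -> C i i = 0.
Proof.
by case=> _ /(_ i i) + _; rewrite eqxx => /eqP; rewrite sqrf_eq0 => /eqP.
Qed.

(** The ring is left general so that one Gram computation serves both [R] and [R[i]]. *)
Definition conference_comb (S : comNzRingType) (n : nat) (C : 'M[int]_n)
    (x y : S) : 'M[S]_n := x%:M + y *: map_mx intr C.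

Lemma conference_combE (S : comNzRingType) (n : nat) (e : int) (C : 'M[int]_n)
    (x y : S) (i j : 'I_n) : conference n e C ->
  conference_comb S n C x y i j = if i == j then x else y * (C i j)%:~R.
Proof.
move=> C_conf; rewrite !mxE; case: eqP => [->|_]; last by rewrite add0r.
by rewrite (conference_diag _ _ _ _ C_conf) mulr0 addr0.
Qed.

Lemma tr_conference_comb (S : comNzRingType) (n : nat) (C : 'M[int]_n)
    (x y : S) : (conference_comb S n C x y)^T = conference_comb S n C^T x y.
Proof. by rewrite /conference_comb linearD linearZ /= tr_scalar_mx map_trmx. Qed.

Lemma map_conference_comb (S T : comNzRingType) (f : {rmorphism S -> T})
    (n : nat) (C : 'M[int]_n) (x y : S) :
  map_mx f (conference_comb S n C x y) = conference_comb T n C (f x) (f y).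
Proof.
rewrite /conference_comb map_mxD map_scalar_mx map_mxZ -map_mx_comp.
by congr (_ + _ *: _); apply: eq_map_mx => z /=; rewrite rmorph_int.
Qed.

(* For [e = -1] the second factor is the transpose of the first one; for
   [e = 1], [x] real and [y] imaginary, it is the adjoint. *)
Lemma conference_comb_gram (S : comNzRingType) (n : nat) (e : int)
    (C : 'M[int]_n) (x y : S) : conference n e C -> e ^+ 2 = 1 ->
  conference_comb S n C x y *m conference_comb S n C^T x (- e%:~R * y) =
  (x ^+ 2 - e%:~R * (n%:R - 1) * y ^+ 2)%:M.
Proof.
case=> C_tr _ C_gram e2; rewrite /conference_comb.
have eS2 : e%:~R * e%:~R = 1 :> S by rewrite -intrM -expr2 e2.
have gramS : map_mx intr C *m map_mx intr C^T = (n%:R - 1)%:M :> 'M[S]_n.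
  by rewrite -map_mxM C_gram map_scalar_mx /= intrB natz.
have trS : map_mx intr C^T = e%:~R *: map_mx intr C :> 'M[S]_n.
  by apply/matrixP=> i j; rewrite C_tr !mxE intrM.
rewrite mulmxDl !mulmxDr -scalar_mxM !mul_scalar_mx mul_mx_scalar.
rewrite -!scalemxAl -!scalemxAr gramS trS.
(* The mixed terms [x y C] and [- e^2 x y C] cancel by [eS2]. *)
apply/matrixP=> i j; rewrite !mxE; move: (_%:~R) (_%:~R) eS2 => c d eS2.
by case: (i == j); rewrite ?mulr1n ?mulr0n; ring: eS2.
Qed.

Lemma ray_entries (R : realType) (n : nat) (P B : 'M[R]_n) :
  (1 < n)%N -> is_perm_mx P -> (ray P `|` counter_ray P) B ->
  exists (s : 'S_n) (u v : R), [/\ 0 <= u, 0 <= v, u + (n%:R - 1) * v = 1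
    & forall i j, B i j = if s i == j then u else v].
Proof.
move=> n_gt1 /is_perm_mxP[s ->] B_ray; exists s.
have n1_gt0 : 0 < n%:R - 1 :> R by rewrite subr_gt0 ltr1n.
have n_gt0 : 0 < n%:R :> R by rewrite ltr0n ltnW.
have [a [a_ge a_le <-]] : exists a, [/\ - (n%:R - 1)^-1 <= a, a <= 1
    & a *: perm_mx s + (1 - a) *: flat_mx R n = B].
  case: B_ray => -[a /= /andP[a_ge a_lt] aB]; exists a; split=> //.
  - by apply: le_trans a_ge; rewrite oppr_le0 invr_ge0 ltW.
  - exact: ltW (lt_trans a_lt ltr01).
exists (a + (1 - a) / n%:R), ((1 - a) / n%:R); split.
(* In this form [0 <= u] is exactly the lower bound on [a] that ends the counter-ray. *)
- have -> : a + (1 - a) / n%:R = (n%:R - 1) * (a + (n%:R - 1)^-1) / n%:R.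
    by field; rewrite !gt_eqF.
  by rewrite divr_ge0 ?mulr_ge0 ?(ltW n1_gt0) ?(ltW n_gt0) // -lerBlDr sub0r.
- by rewrite divr_ge0 ?subr_ge0 ?(ltW n_gt0).
- by field; rewrite gt_eqF.
- by move=> i j; rewrite !mxE; case: eqP; rewrite ?mulr1 ?mulr0 ?add0r.
Qed.

Lemma bistochastic_perm_entries (R : realType) (n : nat) (s : 'S_n) (u v : R)
    (B : 'M[R]_n) :
  0 <= u -> 0 <= v -> u + (n%:R - 1) * v = 1 ->
  (forall i j, B i j = if s i == j then u else v) -> bistochastic B.
Proof.
move=> u_ge0 v_ge0 uv1 BE.
have sum1 k : u + \sum_(i < n | i != k) v = 1.
  rewrite sumr_const cardC1 card_ord -mulr_natl -subn1 natrB //.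
  exact: leq_ltn_trans (ltn_ord k).
split=> [i j|i|j].
- by rewrite BE; case: ifP.
- rewrite (bigD1 (s i)) //= BE eqxx -[RHS](sum1 (s i)); congr (_ + _).
  by apply: eq_bigr => j; rewrite BE eq_sym => /negPf->.
- rewrite (bigD1 (s^-1 j)%g) //= BE permKV eqxx -[RHS](sum1 (s^-1 j)%g).
  congr (_ + _); apply: eq_bigr => i; rewrite BE -(inj_eq (@perm_inj _ s)).
  by rewrite permKV => /negPf->.
Qed.

(** The product is [U *m V] conjugated by a permutation matrix. With [V] the transpose or adjoint of
    [U], permuting rows thus preserves orthogonality and unitarity. *)
Lemma row_perm_mul_col_perm (S : pzSemiRingType) (n : nat) (s : 'S_n)
    (U V : 'M[S]_n) : U *m V = 1%:M -> row_perm s U *m col_perm s V = 1%:M.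
Proof.
move=> UV1; rewrite row_permE col_permE !mulmxA -(mulmxA _ U) UV1 mulmx1.
by rewrite -perm_mxM mulgV perm_mx1.
Qed.

Lemma sqr_norm_imaginary_int (C : numClosedFieldType) (y : C) (c : int) :
  y \is Num.real -> `|'i * y * c%:~R| ^+ 2 = y ^+ 2 * (c ^+ 2)%:~R.
Proof.
move=> y_real; rewrite !normrM normCi mul1r exprMn !real_normK ?realz //.
by rewrite rmorphXn.
Qed.

Theorem mainTheorem1 (R : realType) (n : nat)
    (n_gt0 : (0 < n)%N) (n_even : ~~ odd n) (n_le20 : (n <= 20)%N)
    (P : 'M[R]_n) (P_perm : is_perm_mx P)
    (B : 'M[R]_n) (B_ray : (ray P `|` counter_ray P) B) :
  (n \in [:: 2; 4; 8; 12; 16; 20]%N -> orthostochastic B) /\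
  (n \in [:: 6; 10; 14; 18]%N -> unistochastic B).
Proof.
have n_gt1 : (1 < n)%N by case: n n_gt0 n_even {n_le20 P P_perm B B_ray} => [|[]].
have [s [u [v [u_ge0 v_ge0 uv1 BE]]]] := ray_entries _ _ _ _ n_gt1 P_perm B_ray.
have B_bist := bistochastic_perm_entries _ _ _ _ _ _ u_ge0 v_ge0 uv1 BE.
have entry_sq (C : 'M[int]_n) e (i j : 'I_n) : conference n e C ->
    i != j -> C i j ^+ 2 = 1.
  by case=> _ -> _ ->.
split=> [/skew_conference_exists|/symmetric_conference_exists] [C C_conf];
  split=> //.
- exists (row_perm s (conference_comb R n C (Num.sqrt u) (Num.sqrt v))).
    rewrite /orthogonal_mx tr_row_perm; apply: row_perm_mul_col_perm.
    rewrite tr_conference_comb.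
    (* The second factor is brought to the form [- e%:~R * y] with [e = -1]. *)
    rewrite -[Num.sqrt v in X in _ *m X]mul1r -[X in X * Num.sqrt v]opprK.
    rewrite -mulrN1z.
    rewrite (conference_comb_gram _ _ _ _ _ _ C_conf) // !sqr_sqrtr //.
    by rewrite mulrN1z mulN1r mulNr opprK uv1.
  move=> i j; rewrite BE mxE (conference_combE _ _ _ _ _ _ _ _ C_conf).
  rewrite real_normK ?num_real //; case: ifP => [_|/negbT ij].
    by rewrite sqr_sqrtr.
  rewrite exprMn sqr_sqrtr // -rmorphXn /= (entry_sq _ _ _ _ C_conf ij).
  by rewrite mulr1.
- pose x : R[i] := (Num.sqrt u)%:C%C; pose y : R[i] := (Num.sqrt v)%:C%C.
  have x_real : x \is Num.real by apply: ger0_real; rewrite ler0c sqrtr_ge0.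
  have y_real : y \is Num.real by apply: ger0_real; rewrite ler0c sqrtr_ge0.
  have x2 : x ^+ 2 = u%:C%C by rewrite -rmorphXn /= sqr_sqrtr.
  have y2 : y ^+ 2 = v%:C%C by rewrite -rmorphXn /= sqr_sqrtr.
  exists (row_perm s (conference_comb R[i] n C x ('i * y))).
    apply/unitarymxP; rewrite tr_row_perm map_col_perm.
    apply: row_perm_mul_col_perm.
    rewrite tr_conference_comb map_conference_comb /= (conj_Creal x_real).
    (* Conjugation negates the imaginary coefficient, which is the factor [- e%:~R] for [e = 1]. *)
    have -> : ('i * y)^* = - 1%:~R * ('i * y).
      by rewrite rmorphM /= conjCi (conj_Creal y_real) mulN1r mulNr.
    rewrite (conference_comb_gram _ _ _ _ _ _ C_conf) //.
    rewrite exprMn sqrCi x2 y2 mul1r mulN1r mulrN opprK.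
    congr _%:M; have := congr1 (real_complex R) uv1.
    by rewrite rmorphD rmorphM rmorphB rmorph1 rmorph_nat.
  move=> i j; rewrite BE mxE (conference_combE _ _ _ _ _ _ _ _ C_conf).
  case: ifP => [_|/negbT ij]; first by rewrite real_normK.
  rewrite (sqr_norm_imaginary_int _ _ _ y_real) y2.
  by rewrite (entry_sq _ _ _ _ C_conf ij) mulr1.
Qed.
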